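(* As formal power series in $z$ with rational coefficients, $$\exp\Bigl(\frac{z}{1-z^2}\Bigr)=\prod_{d=1}^{\infty}(1+z^d)^{\varphi(d)/d},$$ where $\varphi$ is Euler's totient function.
   Context: For a rational number $r$, $(1+z^d)^{r}$ denotes the formal binomial series $\exp(r\log(1+z^d))$; the infinite product converges in the usual topology of formal power series. *)

(* Defs.v *)
From HB Require Import structures.
From mathcomp Require Import all_boot all_order all_algebra.
From mathcomp Require Import boolp classical_sets filter topology.

Set Implicit Arguments.
Unset Strict Implicit.
Unset Printing Implicit Defensive.

Import GRing.Theory.
Local Open Scope classical_set_scope.
Local Open Scope ring_scope.

(* Formal power series in one variable, as the sequence of their coefficients:
   [f n] is the coefficient of degree [n] of [f]. *)
Record fps (R : Type) := Fps { fps_coef :> nat -> R }.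

Lemma fpsP (R : Type) (f g : fps R) : f =1 g <-> f = g.
Proof.
split=> [|-> //]; case: f g => [f] [g] /= fg.
by congr Fps; apply/funext.
Qed.

HB.instance Definition _ (R : Type) := gen_eqMixin (fps R).
HB.instance Definition _ (R : Type) := gen_choiceMixin (fps R).

Section Zmodule.
Variable R : zmodType.
Implicit Types f g h : fps R.

Definition fps_zero : fps R := Fps (fun=> 0).
Definition fps_opp f : fps R := Fps (fun n => - f n).
Definition fps_add f g : fps R := Fps (fun n => f n + g n).

Fact fps_addA : associative fps_add.
Proof. by move=> f g h; apply/fpsP => n /=; rewrite addrA. Qed.
Fact fps_addC : commutative fps_add.
Proof. by move=> f g; apply/fpsP => n /=; rewrite addrC. Qed.
Fact fps_add0 : left_id fps_zero fps_add.
Proof. by move=> f; apply/fpsP => n /=; rewrite add0r. Qed.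
Fact fps_addN : left_inverse fps_zero fps_opp fps_add.
Proof. by move=> f; apply/fpsP => n /=; rewrite addNr. Qed.

HB.instance Definition _ := GRing.isZmodule.Build (fps R)
  fps_addA fps_addC fps_add0 fps_addN.

Lemma fps_coef0 n : (0 : fps R) n = 0. Proof. by []. Qed.
Lemma fps_coefN f n : (- f) n = - f n. Proof. by []. Qed.
Lemma fps_coefD f g n : (f + g) n = f n + g n. Proof. by []. Qed.
Lemma fps_coefB f g n : (f - g) n = f n - g n. Proof. by []. Qed.

Lemma fps_coef_sum (I : Type) (r : seq I) (P : pred I) (F : I -> fps R) n :
  (\sum_(i <- r | P i) F i) n = \sum_(i <- r | P i) F i n.
Proof. by elim/big_rec2: _ => //= i y1 y2 _ <-. Qed.

End Zmodule.

Section Ring.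
Variable R : comNzRingType.
Implicit Types f g h : fps R.

Definition fps_one : fps R := Fps (fun n => (n == 0%N)%:R).
Definition fps_mul f g : fps R :=
  Fps (fun n => \sum_(i < n.+1) f i * g (n - i)%N).

(* [f] and the polynomial [p] coincide up to degree [n] *)
Definition fps_agree n f (p : {poly R}) := forall i, (i <= n)%N -> f i = p`_i.

Definition fps_trunc n f : {poly R} := \poly_(i < n.+1) f i.

Lemma fps_agree_trunc n f : fps_agree n f (fps_trunc n f).
Proof. by move=> i lein; rewrite coef_poly ltnS lein. Qed.

Arguments fps_agree_trunc : clear implicits.

Lemma fps_agreeM n f g p q :
  fps_agree n f p -> fps_agree n g q -> fps_agree n (fps_mul f g) (p * q).
Proof.
move=> fp gq i lein; rewrite coefM; apply: eq_bigr => -[j /= ltji] _.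
rewrite fp ?gq // ?(leq_trans _ lein) ?leq_subr //.
Qed.

Lemma fps_agreeD n f g p q :
  fps_agree n f p -> fps_agree n g q -> fps_agree n (f + g) (p + q).
Proof. by move=> fp gq i lein; rewrite coefD fps_coefD fp ?gq. Qed.

Lemma fps_agree1 n : fps_agree n fps_one 1.
Proof. by move=> i lein; rewrite coef1. Qed.

Fact fps_mulA : associative fps_mul.
Proof.
move=> f g h; apply/fpsP => n.
have [A B C] := And3 (fps_agree_trunc n f) (fps_agree_trunc n g)
  (fps_agree_trunc n h).
rewrite (fps_agreeM A (fps_agreeM B C) (leqnn n)).
by rewrite (fps_agreeM (fps_agreeM A B) C (leqnn n)) mulrA.
Qed.

Fact fps_mulC : commutative fps_mul.
Proof.
move=> f g; apply/fpsP => n.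
have [A B] := conj (fps_agree_trunc n f) (fps_agree_trunc n g).
by rewrite (fps_agreeM A B (leqnn n)) (fps_agreeM B A (leqnn n)) mulrC.
Qed.

Fact fps_mul1 : left_id fps_one fps_mul.
Proof.
move=> f; apply/fpsP => n; have A := fps_agree_trunc n f.
by rewrite (fps_agreeM (@fps_agree1 n) A (leqnn n)) mul1r -A.
Qed.

Fact fps_mulDl : left_distributive fps_mul +%R.
Proof.
move=> f g h; apply/fpsP => n.
have [A B C] := And3 (fps_agree_trunc n f) (fps_agree_trunc n g)
  (fps_agree_trunc n h).
rewrite (fps_agreeM (fps_agreeD A B) C (leqnn n)) mulrDl.
by rewrite (fps_agreeD (fps_agreeM A C) (fps_agreeM B C) (leqnn n)).
Qed.

Fact fps_oner_neq0 : fps_one != 0.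
Proof.
apply/eqP => /fpsP /(_ 0%N) /eqP.
by rewrite /= (oner_eq0 R).
Qed.

HB.instance Definition _ := GRing.Zmodule_isComNzRing.Build (fps R)
  fps_mulA fps_mulC fps_mul1 fps_mulDl fps_oner_neq0.

Lemma fps_coef1 n : (1 : fps R) n = (n == 0%N)%:R. Proof. by []. Qed.
Lemma fps_coefM f g n : (f * g) n = \sum_(i < n.+1) f i * g (n - i)%N.
Proof. by []. Qed.

Definition fps_scale (a : R) f : fps R := Fps (fun n => a * f n).

Fact fps_scaleA a b f : fps_scale a (fps_scale b f) = fps_scale (a * b) f.
Proof. by apply/fpsP => n /=; rewrite mulrA. Qed.
Fact fps_scale1 : left_id 1 fps_scale.
Proof. by move=> f; apply/fpsP => n /=; rewrite mul1r. Qed.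
Fact fps_scaleDr : right_distributive fps_scale +%R.
Proof. by move=> a f g; apply/fpsP => n /=; rewrite mulrDr. Qed.
Fact fps_scaleDl f : {morph fps_scale^~ f : a b / a + b}.
Proof. by move=> a b; apply/fpsP => n /=; rewrite mulrDl. Qed.

HB.instance Definition _ := GRing.Zmodule_isLmodule.Build R (fps R)
  fps_scaleA fps_scale1 fps_scaleDr fps_scaleDl.

Lemma fps_coefZ a f n : (a *: f) n = a * f n. Proof. by []. Qed.

Fact fps_scaleAl a f g : a *: (f * g) = a *: f * g.
Proof.
apply/fpsP => n; rewrite fps_coefZ !fps_coefM mulr_sumr.
by apply: eq_bigr => i _; rewrite fps_coefZ mulrA.
Qed.

HB.instance Definition _ :=
  GRing.Lmodule_isLalgebra.Build R (fps R) fps_scaleAl.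

Definition fpsX : fps R := Fps (fun n => (n == 1%N)%:R).

(* If [f] has zero constant term then [f ^+ k] starts in degree at least [k],
   so that the truncated sum below is the coefficient of degree [n] of the
   infinite sum of the [F k *: f ^+ k] (see [cvg_fps_comp]); for other [f] the
   value is meaningless. *)
Definition fps_comp (F f : fps R) : fps R :=
  Fps (fun n => \sum_(k < n.+1) F k * (f ^+ k) n).

Lemma fps_coefX_lt f k n : f 0%N = 0 -> (n < k)%N -> (f ^+ k) n = 0.
Proof.
move=> f0; elim: k n => // k IHk n ltnk.
rewrite exprS fps_coefM big1 // => -[[|i] /= lti] _; first by rewrite f0 mul0r.
by rewrite IHk ?mulr0 //; case: n lti ltnk => // n _; rewrite ltnS subSS;
  apply: leq_ltn_trans (leq_subr _ _).
Qed.

End Ring.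

Arguments fpsX {R}.

Section UnitRing.
Variable R : comUnitRingType.
Implicit Types f g : fps R.

Definition fps_unit : pred (fps R) := fun f => f 0%N \is a GRing.unit.

(* The first [n] coefficients of the inverse of [f], obtained by solving
   [f * g = 1] degree by degree. *)
Fixpoint fps_inv_seq f n : seq R :=
  if n isn't m.+1 then [::] else
  let s := fps_inv_seq f m in
  rcons s ((f 0%N)^-1 * ((m == 0%N)%:R - \sum_(i < m) f (m - i)%N * s`_i)).

Definition fps_inv f : fps R :=
  if fps_unit f then Fps (fun n => (fps_inv_seq f n.+1)`_n) else f.

Lemma size_fps_inv_seq f n : size (fps_inv_seq f n) = n.
Proof. by elim: n => //= n IHn; rewrite size_rcons IHn. Qed.

Lemma nth_fps_inv_seq f n i : (i < n)%N ->
  (fps_inv_seq f n)`_i = (fps_inv_seq f i.+1)`_i.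
Proof.
elim: n => // n IHn; rewrite ltnS leq_eqVlt => /orP[/eqP -> // | ltin].
rewrite [LHS]/= nth_rcons size_fps_inv_seq ltin.
exact: IHn.
Qed.

Fact fps_mulVr : {in fps_unit, left_inverse 1 fps_inv *%R}.
Proof.
move=> f Uf; have Uf0 : f 0%N \is a GRing.unit := Uf.
apply/fpsP => n; rewrite fps_coefM big_ord_recr /= subnn.
rewrite /fps_inv [fps_unit f]Uf0 /= nth_rcons size_fps_inv_seq ltnn eqxx.
rewrite [_ * f 0%N]mulrC mulVKr //.
rewrite (eq_bigr (fun i : 'I_n => f (n - i)%N * (fps_inv_seq f n)`_i)).
  by rewrite addrC subrK.
by move=> -[i /= ltin] _; rewrite mulrC (nth_fps_inv_seq f ltin).
Qed.

Fact fps_unitPl f g : g * f = 1 -> fps_unit f.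
Proof.
move/fpsP/(_ 0%N); rewrite fps_coefM big_ord1 => gf.
by apply/unitrPr; exists (g 0%N); rewrite mulrC.
Qed.

Fact fps_invr_out : {in [predC fps_unit], fps_inv =1 id}.
Proof. by move=> f /negbTE nUf; rewrite /fps_inv [fps_unit f]nUf. Qed.

HB.instance Definition _ := GRing.ComNzRing_hasMulInverse.Build (fps R)
  fps_mulVr fps_unitPl fps_invr_out.

End UnitRing.

(* The usual topology: the sets of series agreeing with [f] in all degrees
   less than [n] form a basis of neighbourhoods of [f]. *)
Section Topology.
Variable R : Type.
Implicit Types f g : fps R.

Definition fps_nbhs f : set_system (fps R) :=
  [set A | exists n, forall g, (forall k, (k < n)%N -> g k = f k) -> A g].

Fact fps_nbhs_filter f : ProperFilter (fps_nbhs f).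
Proof.
split; first by case=> n /(_ f); exact.
split=> [|A B [n An] [m Bm]|A B AB [n An]]; first by exists 0%N.
- exists (maxn n m) => g fg; split; [apply: An | apply: Bm] => k ltk;
  by apply: fg; rewrite leq_max ltk ?orbT.
- by exists n => g fg; apply/AB/An.
Qed.

Fact fps_nbhs_singleton f (A : set (fps R)) : fps_nbhs f A -> A f.
Proof. by case=> n; apply. Qed.

Fact fps_nbhs_nbhs f (A : set (fps R)) :
  fps_nbhs f A -> fps_nbhs f (fps_nbhs^~ A).
Proof.
case=> n An; exists n => g fg; exists n => h gh; apply: An => k ltk.
by rewrite gh ?fg.
Qed.

HB.instance Definition _ := hasNbhs.Build (fps R) fps_nbhs.
HB.instance Definition _ := Nbhs_isNbhsTopological.Build (fps R)
  fps_nbhs_filter fps_nbhs_singleton fps_nbhs_nbhs.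

Lemma cvg_fpsP (u : nat -> fps R) f :
  u @ \oo --> f <->
  forall k, exists N, forall n, (N <= n)%N -> u n k = f k.
Proof.
split=> [uf k|uf A [n An]].
  have [|N _ uN] := uf [set g : fps R | g k = f k]; last by exists N.
  by exists k.+1 => g; apply.
have [N uN] : exists N, forall m, (N <= m)%N ->
    forall k, (k < n)%N -> u m k = f k.
  elim: n {An} => [|n [N IHn]]; first by exists 0%N.
  have [M uM] := uf n; exists (maxn N M) => m.
  rewrite geq_max => /andP[leNm leMm] k; rewrite ltnS leq_eqVlt.
  by case/orP=> [/eqP ->|]; [exact: uM | exact: IHn].
by exists N => // m /= leNm; apply: An; exact: uN.
Qed.

Lemma fps_hausdorff : hausdorff_space (fps R).
Proof.
move=> f g fg; apply/fpsP => k.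
have [||h [/= <- <-]] // :=
  fg [set h : fps R | h k = f k] [set h : fps R | h k = g k];
  by exists k.+1 => h; apply.
Qed.

End Topology.

Lemma cvg_fps_comp (R : comNzRingType) (F f : fps R) : f 0%N = 0 ->
  (fun n => \sum_(k < n) F k *: f ^+ k) @ \oo --> fps_comp F f.
Proof.
move=> f0; apply/cvg_fpsP => m; exists m.+1 => n lemn.
rewrite fps_coef_sum -(subnKC lemn) big_split_ord.
rewrite /= [X in _ + X]big1 ?addr0 //.
by move=> i _; rewrite (fps_coefX_lt f0) ?mulr0 //= leq_addr.
Qed.

(* [fps_exp f] is meaningful when the constant term of [f] is 0, and
   [fps_log f], [fps_rpow f r] when the constant term of [f] is 1. *)
Definition fps_exp (f : fps rat) : fps rat :=
  fps_comp (Fps (fun k => (k`!%:R)^-1)) f.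

(* In degree 0 the coefficient below is [- 1 / 0 = 0]. *)
Definition fps_log (f : fps rat) : fps rat :=
  fps_comp (Fps (fun k => (-1) ^+ k.+1 / k%:R)) (f - 1).

Definition fps_rpow (f : fps rat) (r : rat) : fps rat :=
  fps_exp (r *: fps_log f).

(* Main.v *)
(** Taking logarithms, the coefficient of [z^n] on the right is
    [1/n * sum_(d | n) phi(d) (-1)^(n/d + 1)]. Gauss's identity
    [sum_(d | n) phi(d) = n], applied to [n] and, when [n] is even, to [n/2],
    shows that this is [1] for odd [n] and [0] for even [n]. *)

Require Import Defs.
From mathcomp Require Import all_boot all_order all_algebra.
From mathcomp Require Import cyclic.
From mathcomp Require Import classical_sets filter topology.

Import GRing.Theory.
Local Open Scope classical_set_scope.
Local Open Scope ring_scope.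

Section Coefficients.
Variable R : comNzRingType.
Implicit Types f g : fps R.

Lemma fps_coefM_eq_le f f' g g' n :
  (forall i, (i <= n)%N -> f i = f' i) ->
  (forall i, (i <= n)%N -> g i = g' i) ->
  forall i, (i <= n)%N -> (f * g) i = (f' * g') i.
Proof.
move=> ff' gg' i lein; rewrite !fps_coefM; apply: eq_bigr => -[j /= ltji] _.
by rewrite ff' ?gg' // (leq_trans _ lein) ?leq_subr.
Qed.

Lemma fps_coefX_eq_le f g n :
  (forall i, (i <= n)%N -> f i = g i) ->
  forall k i, (i <= n)%N -> (f ^+ k) i = (g ^+ k) i.
Proof.
move=> fg; elim=> [|k IHk] i lein; first by rewrite !expr0.
by rewrite !exprS; apply: (@fps_coefM_eq_le _ _ _ _ n).
Qed.

(** Powers up to degree [n] only involve coefficients up to degree [n]. This reduces comparing two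
    exponentials in degree [n] to comparing their exponents. *)
Lemma fps_comp_eq_le (F : fps R) f g n :
  (forall i, (i <= n)%N -> f i = g i) -> fps_comp F f n = fps_comp F g n.
Proof.
by move=> fg /=; apply: eq_bigr => k _; rewrite (@fps_coefX_eq_le f g n).
Qed.

Lemma fps_coefMX_vanish f g i j n :
  f 0%N = 0 -> g 0%N = 0 -> (n < i + j)%N -> (f ^+ i * g ^+ j) n = 0.
Proof.
move=> f0 g0 ltn; rewrite fps_coefM big1 // => -[k /= ltk] _.
have [ltki|leik] := ltnP k i; first by rewrite fps_coefX_lt ?mul0r.
rewrite [X in _ * X]fps_coefX_lt ?mulr0 //.
by rewrite ltn_subLR // (leq_trans ltn) // leq_add2r.
Qed.

Lemma fps_coef_XM f n : (fpsX * f) n.+1 = f n.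
Proof.
rewrite fps_coefM !big_ord_recl /= mul0r add0r mul1r subSS subn0.
by rewrite big1 ?addr0 // => i _; rewrite mul0r.
Qed.

Lemma fps_coef_XM0 f : (fpsX * f) 0%N = 0.
Proof. by rewrite fps_coefM big_ord1 mul0r. Qed.

Lemma fps_coefXn d n : ((fpsX : fps R) ^+ d) n = (n == d)%:R.
Proof.
elim: d n => [|d IHd] [|n]; rewrite ?expr0 ?exprS ?fps_coef_XM0 //.
by rewrite fps_coef_XM IHd eqSS.
Qed.

End Coefficients.

(** The binomial theorem turns the left side into a sum of [a i j] over the triangle [i + j <= n],
    while the product gives the square [i, j <= n]; the terms in between vanish since
    [f ^+ i * g ^+ j] starts in degree at least [i + j]. *)
Lemma fps_expD (f g : fps rat) : f 0%N = 0 -> g 0%N = 0 ->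
  fps_exp (f + g) = fps_exp f * fps_exp g.
Proof.
move=> f0 g0; apply/fpsP => n.
(* [fps_comp] cuts its sum at a bound that varies with the degree; [E] uses the same cut for all
   degrees up to [n], so that the product becomes one of two finite sums. *)
pose E (h : fps rat) : fps rat := \sum_(k < n.+1) (k`!%:R)^-1 *: h ^+ k.
have expE (h : fps rat) : h 0%N = 0 -> forall i, (i <= n)%N -> fps_exp h i = E h i.
  move=> h0 i lein; rewrite /E fps_coef_sum /=.
  rewrite (big_ord_widen n.+1 (fun k => (k`!%:R)^-1 * (h ^+ k) i)) //.
  rewrite big_mkcond /=; apply: eq_bigr => k _.
  by case: ltnP => // ltik; rewrite fps_coefX_lt ?mulr0.
rewrite (@fps_coefM_eq_le _ _ (E f) _ (E g) n (expE f f0) (expE g g0)) //.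
pose a i j : rat := (i`!%:R)^-1 * (j`!%:R)^-1 * (f ^+ i * g ^+ j) n.
transitivity (\sum_(i < n.+1) \sum_(j < n.+1) a i j); last first.
  rewrite /E mulr_suml fps_coef_sum; apply: eq_bigr => i _.
  rewrite mulr_sumr fps_coef_sum; apply: eq_bigr => j _.
  rewrite -scalerAl fps_coefZ [_ ^+ i * _]mulrC -scalerAl fps_coefZ.
  by rewrite mulrA [g ^+ j * _]mulrC.
transitivity (\sum_(k < n.+1) \sum_(j < n.+1 | (j <= k)%N) a (k - j)%N j).
  rewrite /=; apply: eq_bigr => k _.
  rewrite exprDn fps_coef_sum mulr_sumr.
  rewrite (big_ord_widen n.+1 (fun j => (k`!%:R)^-1 *
     ((f ^+ (k - j) * g ^+ j) *+ 'C(k, j)) n)) //.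
  apply: eq_bigr => j lejk; rewrite ltnS in lejk.
  rewrite -scaler_nat fps_coefZ mulrA; congr (_ * _).
  have nz m : m`!%:R != 0 :> rat by rewrite Num.Theory.pnatr_eq0 -lt0n fact_gt0.
  apply: (mulfI (nz k)); rewrite mulVKf //.
  rewrite -invfM -natrM [((k - j)`! * _)%N]mulnC -(bin_fact lejk) natrM mulfK //.
  by rewrite natrM mulf_neq0.
(* For fixed [j], the substitution [i = k - j] makes the triangle's row run over [i < n.+1 - j]; the
   rest of the square's row has [i + j > n]. *)
rewrite (exchange_big_dep predT) //= [RHS]exchange_big /=; apply: eq_bigr => j _.
rewrite -(big_mkord (fun k => (j <= k)%N) (fun k => a (k - j)%N j)).
rewrite (big_cat_nat (leq0n j)) /=; last exact: ltnW.
rewrite big_nat_cond big1 ?add0r; last first.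
  by move=> k /andP[/andP[_ ltkj] lejk]; rewrite leqNgt ltkj in lejk.
rewrite -{1}[nat_of_ord j]add0n big_addn.
rewrite -(big_mkord predT (fun i => a i j)).
rewrite [RHS](big_cat_nat (leq0n (n.+1 - j))) ?leq_subr //=.
rewrite [X in _ = _ + X]big_nat [X in _ = _ + X]big1 ?addr0; last first.
  move=> i /andP[lei _]; rewrite /a fps_coefMX_vanish ?mulr0 //.
  by rewrite addnC -leq_subLR.
by apply: eq_big => [i|i _]; rewrite ?leq_addl ?addnK.
Qed.

Lemma fps_exp0 : fps_exp 0 = 1.
Proof.
apply/fpsP => n; rewrite /= big_ord_recl expr0 fact0 invr1 mul1r big1 ?addr0 //.
by move=> i _; rewrite exprS mul0r mulr0.
Qed.

Lemma fps_exp_sum (I : Type) (r : seq I) (F : I -> fps rat) :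
  (forall i, F i 0%N = 0) ->
  fps_exp (\sum_(i <- r) F i) = \prod_(i <- r) fps_exp (F i).
Proof.
move=> F0; elim: r => [|i r IHr]; first by rewrite !big_nil fps_exp0.
by rewrite !big_cons fps_expD ?IHr // fps_coef_sum big1.
Qed.

(** Only the power [k] with [d * k = n] contributes in degree [n]. For [n = 0] the right side is
    again [- 1 / 0 = 0]. *)
Lemma fps_coef_log1Xn d n : (0 < d)%N ->
  fps_log (1 + fpsX ^+ d) n =
  if (d %| n)%N then (-1) ^+ (n %/ d).+1 / (n %/ d)%:R else 0.
Proof.
move=> d0; rewrite /fps_log addrAC subrr add0r /=.
under eq_bigr do rewrite -exprM fps_coefXn.
case: ifPn => [/dvdnP[q nE] | ndn]; last first.
  rewrite big1 // => k _; case: eqP => [nE|_]; last by rewrite mulr0.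
  by rewrite nE dvdn_mulr in ndn.
have {}nE : n = (d * q)%N by rewrite nE mulnC.
have ltq : (q < n.+1)%N by rewrite ltnS nE leq_pmull.
have -> : (n %/ d)%N = q by rewrite nE mulKn.
rewrite (bigD1 (Ordinal ltq)) //= -nE eqxx mulr1.
rewrite big1 ?addr0 // => k nkq.
case: eqP => [nEk|_]; last by rewrite mulr0.
case/eqP: nkq; apply/val_inj/eqP.
by rewrite /= -(eqn_pmul2l d0) -nEk nE.
Qed.

Lemma fps_coef_log0 (f : fps rat) : fps_log f 0%N = 0.
Proof. by rewrite /= big_ord1 invr0 mulr0 mul0r. Qed.

(** Both sides say that [n = 2 * q * d] for some [q]. The bound [d <= n./2] is the range condition
    that appears when a sum over the divisors of [n./2] is widened to indices up to [n]. *)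
Lemma dvdn_half_even d n : (0 < n)%N -> ~~ odd n ->
  ((d %| n) && ~~ odd (n %/ d) = (d %| n./2) && (d <= n./2))%N.
Proof.
move=> n0 even_n; have nE : n = (n./2 * 2)%N by rewrite muln2 even_halfK.
have m0 : (0 < n./2)%N by move: n0; rewrite {1}nE muln_gt0 andbT.
apply/andP/andP => [[dn]|[/dvdnP[q mE] _]]; last first.
  rewrite nE mE mulnAC dvdn_mull // mulnK; first by rewrite muln2 odd_double.
  by move: m0; rewrite mE muln_gt0; case/andP.
rewrite -dvdn2 => /dvdnP[q qE]; have dm : (d %| n./2)%N.
  apply/dvdnP; exists q; apply/eqP; rewrite -(eqn_pmul2r (ltn0Sn 1)) -nE.
  by rewrite mulnAC -qE divnK.
by rewrite dm dvdn_leq.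
Qed.

Lemma sum_totient_sign (R : pzRingType) n : (0 < n)%N ->
  \sum_(d < n.+1 | (d %| n)%N) (totient d)%:R * (-1) ^+ (n %/ d)%N.+1
    = (odd n)%:R * n%:R :> R.
Proof.
(* This splits the signed sum into the full totient sum minus twice the part where [n %/ d] is
   even. *)
move=> n0; have sgnE q : (-1) ^+ q.+1 = 1 - (~~ odd q)%:R *+ 2 :> R.
  rewrite -signr_odd /=; case: (odd q); rewrite ?mul0rn ?subr0 //=.
  by rewrite expr1 mulr2n opprD addNKr.
under eq_bigr do rewrite sgnE mulrBr mulr1 mulrnAr -natrM.
rewrite sumrB sumrMnl -!natr_sum sum_totient_dvd.
have [odd_n|even_n] := boolP (odd n).
  rewrite big1 ?mul0rn ?subr0 ?mul1r // => d dn.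
  by rewrite -(divnK dn) oddM in odd_n; case/andP: odd_n => ->; rewrite muln0.
rewrite mul0r; apply/eqP; rewrite subr_eq0 -mulrnA eq_sym; apply/eqP.
congr _%:R.
have nE : n = (n./2 * 2)%N by rewrite muln2 even_halfK.
(* It remains that the totients of the [d] with even cofactor add up to [n./2], which is Gauss's
   identity for [n./2]. *)
rewrite [RHS]nE; congr (_ * 2)%N; rewrite -[RHS]sum_totient_dvd.
have len : (n./2.+1 <= n.+1)%N.
  by rewrite ltnS leq_half_double -addnn -addnS leq_addr.
rewrite [RHS](big_ord_widen_cond _ (fun d => d %| n./2)%N totient len).
rewrite big_mkcond [RHS]big_mkcond /=; apply: eq_bigr => d _.
rewrite ltnS -dvdn_half_even //.
by case: (d %| n)%N; case: (odd _); rewrite ?muln0 ?muln1.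
Qed.

Lemma fps_coef_XdivB (R : comUnitRingType) n :
  ((fpsX : fps R) / (1 - fpsX ^+ 2)) n = (odd n)%:R.
Proof.
(* The candidate quotient z + z^3 + z^5 + ..., checked by multiplying back. *)
pose h : fps R := Fps (fun n => (odd n)%:R).
have u : (1 - fpsX ^+ 2 : fps R) \is a GRing.unit.
  change ((1 - fpsX ^+ 2 : fps R) 0%N \is a GRing.unit).
  by rewrite fps_coefB fps_coefXn subr0 unitr1.
suff hE : h * (1 - fpsX ^+ 2) = fpsX by rewrite -[X in X / _]hE mulrK.
rewrite mulrBr mulr1 [h * _]mulrC exprS expr1 -mulrA; apply/fpsP => -[|[|k]].
- by rewrite fps_coefB fps_coef_XM0 subr0.
- by rewrite fps_coefB fps_coef_XM fps_coef_XM0 subr0.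
by rewrite fps_coefB !fps_coef_XM /= negbK subrr.
Qed.

Theorem mainTheorem3 :
  (fun n : nat => \prod_(1 <= d < n.+1)
     fps_rpow (1 + fpsX ^+ d) ((totient d)%:R / d%:R)) @ \oo
  --> fps_exp (fpsX / (1 - fpsX ^+ 2)).
Proof.
pose L d : fps rat := (totient d)%:R / d%:R *: fps_log (1 + fpsX ^+ d).
have L0 d : L d 0%N = 0 by rewrite fps_coefZ fps_coef_log0 mulr0.
(* Factors with [d > k] differ from 1 only in degrees above [k], so the coefficient of degree [k] is
   stable from [n = k] on. *)
apply/cvg_fpsP => k; exists k => n lekn.
transitivity (fps_exp (\sum_(1 <= d < n.+1) L d) k).
  by rewrite fps_exp_sum.
apply: fps_comp_eq_le => i leik; rewrite fps_coef_XdivB fps_coef_sum.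
(* Degree 0 is set apart because the other degrees are compared after multiplication by [i], which
   clears the denominators [d] and [i %/ d] at once. *)
have [->|i0] := posnP i; first by rewrite big1.
have iz : i%:R != 0 :> rat by rewrite Num.Theory.pnatr_eq0 -lt0n.
pose c d : rat := (totient d)%:R * (-1) ^+ (i %/ d)%N.+1.
have LE d : (0 < d)%N -> L d i * i%:R = if (d %| i)%N then c d else 0.
  move=> d0; rewrite /L fps_coefZ fps_coef_log1Xn //.
  case: ifP => [di|_]; last by rewrite mulr0 mul0r.
  have dz : d%:R != 0 :> rat by rewrite Num.Theory.pnatr_eq0 -lt0n.
  have qz : (i %/ d)%:R != 0 :> rat.
    by rewrite Num.Theory.pnatr_eq0 -lt0n divn_gt0 // dvdn_leq.
  rewrite -{3}(divnK di) natrM -mulrA [X in _ * X]mulrA divfK //.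
  by rewrite [_ * d%:R]mulrC mulrA divfK.
apply: (mulIf iz); rewrite -(sum_totient_sign _ i i0) mulr_suml.
rewrite (eq_big_nat _ _
  (F2 := fun d => if (d %| i)%N then c d else 0)); last first.
  by move=> d /andP[d0 _]; apply: LE.
(* Indices [d > i] do not divide [i]; neither does [d = 0], which the sum in [sum_totient_sign]
   includes in its range. *)
rewrite (big_cat_nat (n := i.+1)) //=; last exact: leq_trans leik lekn.
rewrite [X in _ + X]big_nat [X in _ + X]big1 ?addr0; last first.
  by move=> d /andP[ltid _]; rewrite gtnNdvd.
rewrite -(big_mkord (fun d => d %| i)%N c) [RHS]big_ltn_cond // dvd0n gtn_eqF //.
by rewrite [RHS]big_mkcond.
Qed.
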